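(* Let $K$ be a quadratic field with embeddings into $\mathbb{R}$ and $\mathbb{Q}_2$, and let $\alpha\in K\setminus\mathbb{Q}$ have property $I$. Let $p_n/q_n$ be the convergents of $\alpha$ obtained from the algorithm described in the context. Then, in $\mathbb{R}$, $$\alpha_\infty=\lim_{n\to\infty}\frac{p_n}{q_n}.$$
   Context: $K$ is a quadratic field with fixed field embeddings $\sigma_\infty:K\to\mathbb{R}$ and $\sigma_2:K\to\mathbb{Q}_2$. For $\alpha\in K$ write $\alpha_\infty=\sigma_\infty(\alpha)$, $\alpha_{\langle 2\rangle}=\sigma_2(\alpha)$. For $u=\sum_{n}c_n2^n\in\mathbb{Q}_2$ with digits $c_n\in\{0,1\}$ ($c_n=0$ for $n<v_2(u)$), put $\lfloor u\rfloor_2=\sum_{n\le 0}c_n2^n\in\mathbb{Z}[1/2]$. Property $I$: $\alpha_\infty\in(-1,1]$ and $v_2(\alpha_{\langle 2\rangle})>0$. For $\alpha\in K^\times$ let $a^{(0)}(\alpha)=2m+\lfloor(1/\alpha)_{\langle 2\rangle}\rfloor_2$, where $m$ is the smallest among the integers $i$ minimizing $|(1/\alpha)_\infty-2i-\lfloor(1/\alpha)_{\langle 2\rangle}\rfloor_2|$; let $a^{(1)}(\alpha)=m'+\lfloor(1/\alpha)_{\langle 2\rangle}\rfloor_2$, where $m'$ is the smallest among the integers $i$ minimizing $|(1/\alpha)_\infty-i-\lfloor(1/\alpha)_{\langle 2\rangle}\rfloor_2|$. Put $T_{2,\epsilon}(\alpha)=\frac1\alpha-a^{(\epsilon)}(\alpha)$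 for $\epsilon\in\{0,1\}$. Algorithm: $\alpha_{(1)}=\alpha$; for $n\ge1$ put $\epsilon=0$ if $n$ is even, $\epsilon=1$ if $n$ is odd, $a_n(\alpha)=a^{(\epsilon)}(\alpha_{(n)})$ and $\alpha_{(n+1)}=T_{2,\epsilon}(\alpha_{(n)})$ (for $\alpha\in K\setminus\mathbb{Q}$ the algorithm never terminates). Convergents: $p_0=0$, $q_0=1$, and for $n\ge1$ $$\begin{pmatrix} p_{n-1} & p_n \\ q_{n-1} & q_n \end{pmatrix}=\begin{pmatrix} 0 & 1 \\ 1 & a_1(\alpha) \end{pmatrix}\cdots\begin{pmatrix} 0 & 1 \\ 1 & a_n(\alpha) \end{pmatrix};$$ $p_n,q_n\in\mathbb{Z}[1/2]$ and $q_n\ne0$. *)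

(* Defs.v *)
From HB Require Import structures.
From mathcomp Require Import all_boot all_order all_algebra all_field.
From mathcomp Require Import boolp classical_sets fsbigop.
From mathcomp Require Import reals constructive_ereal topology normedtype.
From mathcomp Require Import sequences.

Set Implicit Arguments.
Unset Strict Implicit.
Unset Printing Implicit Defensive.

Import Order.TTheory GRing.Theory Num.Theory.
Import numFieldNormedType.Exports.

Local Open Scope ring_scope.

(* A 2-adic integer is the stream of its binary digits.                       *)
Record Z2 := MkZ2 { digit : nat -> bool }.

HB.instance Definition _ := gen_eqMixin Z2.
HB.instance Definition _ := gen_choiceMixin Z2.

Section TwoAdicIntegers.
Local Open Scope nat_scope.

Implicit Types (x y z : Z2) (n i j k : nat).

Definition trunc x n := \sum_(i < n) digit x i * 2 ^ i.

Definition coherent (t : nat -> nat) := forall n, t n.+1 = t n %[mod 2 ^ n].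

(* The 2-adic integer congruent to t n mod 2 ^ n for all n, t being coherent. *)
Definition ofSeq (t : nat -> nat) := MkZ2 (fun i => odd (t i.+1 %/ 2 ^ i)).

Lemma truncS x n : trunc x n.+1 = trunc x n + digit x n * 2 ^ n.
Proof. by rewrite /trunc big_ord_recr. Qed.

Lemma trunc0 x : trunc x 0 = 0.
Proof. by rewrite /trunc big_ord0. Qed.

Lemma trunc_lt x n : trunc x n < 2 ^ n.
Proof.
elim: n => [|n IH]; first by rewrite trunc0.
rewrite truncS expnS mul2n -addnn -addSn leq_add //.
by case: (digit x n); rewrite ?mul1n ?mul0n.
Qed.

Lemma trunc_coherent x : coherent (trunc x).
Proof. by move=> n; rewrite truncS addnC modnMDl. Qed.

Lemma trunc_ofSeq t : coherent t -> forall n, trunc (ofSeq t) n = t n %% 2 ^ n.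
Proof.
move=> ct; elim=> [|n IH]; first by rewrite trunc0 expn0 modn1.
rewrite truncS IH -ct /=.
set q := t n.+1 %/ 2 ^ n; set r := t n.+1 %% 2 ^ n.
have -> : t n.+1 = q./2 * 2 ^ n.+1 + (r + odd q * 2 ^ n).
  rewrite [LHS](divn_eq _ (2 ^ n)) -/q -/r -{1}(odd_double_half q).
  by rewrite mulnDl -muln2 -mulnA -expnS addnAC addnC (addnC r).
rewrite modnMDl modn_small // expnS mul2n -addnn -addSn.
by rewrite leq_add ?ltn_mod ?expn_gt0 //; case: odd; rewrite ?mul1n ?mul0n.
Qed.

Lemma trunc_inj x y : (forall n, trunc x n = trunc y n) -> x = y.
Proof.
case: x y => [x] [y] h; congr MkZ2; apply: funext => n.
have := h n.+1; rewrite !truncS h => /addnI /eqP.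
by rewrite eqn_mul2r expn_eq0 /= => /eqP; case: (x n); case: (y n).
Qed.

Lemma trunc_mod x n k : k <= n -> trunc x n %% 2 ^ k = trunc x k.
Proof.
move=> /subnKC <-; elim: (n - k) => [|m IH].
  by rewrite addn0 modn_small ?trunc_lt.
by rewrite addnS truncS expnD mulnCA addnC mulnC modnMDl.
Qed.

Lemma trunc_modS x n : trunc x n.+1 = trunc x n %[mod 2 ^ n].
Proof. exact: trunc_coherent. Qed.

Definition addZ2 x y := ofSeq (fun n => trunc x n + trunc y n).
Definition mulZ2 x y := ofSeq (fun n => trunc x n * trunc y n).
Definition oppZ2 x := ofSeq (fun n => 2 ^ n - trunc x n).
Definition zeroZ2 := MkZ2 (fun=> false).
Definition oneZ2 := MkZ2 (fun i => i == 0).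

Lemma trunc_zeroZ2 n : trunc zeroZ2 n = 0.
Proof. by rewrite /trunc big1. Qed.

Lemma trunc_oneZ2 n : trunc oneZ2 n = 1 %% 2 ^ n.
Proof.
case: n => [|n]; first by rewrite trunc0 expn0 modn1.
rewrite modn_small ?expnS ?mul2n -?addnn; last first.
  by rewrite -addn1 leq_add ?expn_gt0.
by rewrite /trunc big_ord_recl big1.
Qed.

Lemma trunc_addZ2 x y n :
  trunc (addZ2 x y) n = (trunc x n + trunc y n) %% 2 ^ n.
Proof.
apply: trunc_ofSeq => {}n.
by rewrite -modnDm !trunc_modS modnDm.
Qed.

Lemma trunc_mulZ2 x y n :
  trunc (mulZ2 x y) n = (trunc x n * trunc y n) %% 2 ^ n.
Proof.
apply: trunc_ofSeq => {}n.
by rewrite -modnMm !trunc_modS modnMm.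
Qed.

Lemma trunc_oppZ2 x n : trunc (oppZ2 x) n = (2 ^ n - trunc x n) %% 2 ^ n.
Proof.
apply: trunc_ofSeq => {}n.
apply/eqP; rewrite -(eqn_modDr (trunc x n)) subnK 1?ltnW ?trunc_lt //.
rewrite -modnDmr -trunc_modS modnDmr subnK 1?ltnW ?trunc_lt //.
by rewrite expnS modnMl modnn.
Qed.

Lemma addZ2A : associative addZ2.
Proof.
move=> x y z; apply: trunc_inj => n.
by rewrite !trunc_addZ2 modnDmr modnDml addnA.
Qed.

Lemma addZ2C : commutative addZ2.
Proof. by move=> x y; apply: trunc_inj => n; rewrite !trunc_addZ2 addnC. Qed.

Lemma add0Z2 : left_id zeroZ2 addZ2.
Proof.
move=> x; apply: trunc_inj => n.
by rewrite trunc_addZ2 trunc_zeroZ2 add0n modn_small ?trunc_lt.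
Qed.

Lemma addNZ2 : left_inverse zeroZ2 oppZ2 addZ2.
Proof.
move=> x; apply: trunc_inj => n.
rewrite trunc_addZ2 trunc_zeroZ2 trunc_oppZ2 modnDml.
by rewrite subnK 1?ltnW ?trunc_lt // modnn.
Qed.

Lemma mulZ2A : associative mulZ2.
Proof.
move=> x y z; apply: trunc_inj => n.
by rewrite !trunc_mulZ2 modnMmr modnMml mulnA.
Qed.

Lemma mulZ2C : commutative mulZ2.
Proof. by move=> x y; apply: trunc_inj => n; rewrite !trunc_mulZ2 mulnC. Qed.

Lemma mul1Z2 : left_id oneZ2 mulZ2.
Proof.
move=> x; apply: trunc_inj => n.
by rewrite trunc_mulZ2 trunc_oneZ2 modnMml mul1n modn_small ?trunc_lt.
Qed.

Lemma mulZ2Dl : left_distributive mulZ2 addZ2.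
Proof.
move=> x y z; apply: trunc_inj => n.
rewrite trunc_mulZ2 !trunc_addZ2 !trunc_mulZ2 modnMml modnDm.
by rewrite mulnDl.
Qed.

Lemma oneZ2_neq0 : oneZ2 != zeroZ2.
Proof. by apply/eqP => -[] /(congr1 (@^~ 0)). Qed.

End TwoAdicIntegers.

HB.instance Definition _ :=
  GRing.isZmodule.Build Z2 addZ2A addZ2C add0Z2 addNZ2.
HB.instance Definition _ :=
  GRing.Zmodule_isComNzRing.Build Z2 mulZ2A mulZ2C mul1Z2 mulZ2Dl oneZ2_neq0.

Section TwoAdicDomain.

Implicit Types (x y z : Z2) (n i j k : nat).

Lemma truncD x y n : trunc (x + y) n = ((trunc x n + trunc y n) %% 2 ^ n)%N.
Proof. exact: trunc_addZ2. Qed.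

Lemma truncM x y n : trunc (x * y) n = ((trunc x n * trunc y n) %% 2 ^ n)%N.
Proof. exact: trunc_mulZ2. Qed.

Lemma trunc_nat m n : trunc m%:R n = (m %% 2 ^ n)%N.
Proof.
elim: m => [|m IH]; first by rewrite mod0n; exact: trunc_zeroZ2.
rewrite -natr1 truncD IH; have -> : trunc 1 n = (1 %% 2 ^ n)%N.
  exact: trunc_oneZ2.
by rewrite modnDm addn1.
Qed.

(* The inverse, for multiplication mod 2 ^ n, of an odd residue.              *)
Let invSeq x n := ((egcdn (trunc x n) (2 ^ n)).1)%N.

Lemma digit_odd x n : odd (trunc x n.+1) = digit x 0.
Proof.
have := @trunc_mod x n.+1 1 isT; rewrite (truncS x 0) trunc0 expn0 muln1.
by rewrite add0n expn1 modn2; case: odd; case: digit.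
Qed.

Let invSeqP x n : digit x 0 -> (invSeq x n * trunc x n = 1 %[mod 2 ^ n])%N.
Proof.
case: n => [|n] x0; first by rewrite expn0 !modn1.
rewrite /invSeq; case: egcdnP => [|u v /= e _].
  by case: trunc (digit_odd x n) => //=; rewrite x0.
have /eqP g1 : coprime (trunc x n.+1) (2 ^ n.+1).
  by rewrite coprimeXr // coprimen2 digit_odd.
by rewrite e g1 modnMDl.
Qed.

Let invSeq_coherent x : digit x 0 -> coherent (invSeq x).
Proof.
move=> x0 n; set s := invSeq x n.+1; set t := invSeq x n.
have ht : (t * trunc x n = 1 %[mod 2 ^ n])%N by exact: invSeqP.
have hs : (s * trunc x n = 1 %[mod 2 ^ n])%N.
  rewrite -modnMmr -trunc_modS modnMmr.
  have := congr1 (modn^~ (2 ^ n)%N) (@invSeqP x n.+1 x0).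
  by rewrite !modn_dvdm ?dvdn_exp2l.
rewrite -[s in LHS]muln1 -modnMmr -ht modnMmr mulnCA -modnMmr hs modnMmr.
by rewrite muln1.
Qed.

Definition unitZ2 : {pred Z2} := fun x => digit x 0.
Definition invZ2 x := if digit x 0 then ofSeq (invSeq x) else x.

Lemma mulVZ2 : {in unitZ2, left_inverse 1 invZ2 *%R}.
Proof.
move=> x; rewrite unfold_in => x0; apply: trunc_inj => n.
rewrite truncM /invZ2 x0 trunc_ofSeq ?modnMml; last first.
  exact: invSeq_coherent.
by rewrite invSeqP // trunc_oneZ2.
Qed.

Lemma unitZ2P x y : y * x = 1 -> unitZ2 x.
Proof.
move=> /(congr1 (fun z => odd (trunc z 1))).
rewrite truncM [trunc 1 1]trunc_oneZ2 expn1 !modn2 !oddb oddM.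
by rewrite !digit_odd => /andP[].
Qed.

Lemma invZ2_out : {in [predC unitZ2], invZ2 =1 id}.
Proof. by move=> x; rewrite inE unfold_in /invZ2 => /negPf ->. Qed.

End TwoAdicDomain.

HB.instance Definition _ :=
  GRing.ComNzRing_hasMulInverse.Build Z2 mulVZ2 unitZ2P invZ2_out.

(* The index of the lowest nonzero digit (0 for x = 0).                       *)
Definition ordZ2 (x : Z2) : nat :=
  if pselect (exists i, digit x i) is left h then ex_minn h else 0%N.

(* x divided by 2 ^ k, forgetting its k lowest digits.                        *)
Definition dropZ2 (k : nat) (x : Z2) : Z2 := MkZ2 (fun i => digit x (k + i)).

Section TwoAdicOrder.

Implicit Types (x y z : Z2) (n i j k : nat).

Lemma digit_ordZ2 x : x != 0 -> digit x (ordZ2 x).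
Proof.
rewrite /ordZ2; case: pselect => [h|h] x0; first by case: ex_minnP.
case/eqP: x0; apply: trunc_inj => n; rewrite [RHS]trunc_zeroZ2 /trunc big1 //.
by move=> i _; case E: digit => //; case: h; exists i.
Qed.

Lemma ordZ2_min x i : digit x i -> (ordZ2 x <= i)%N.
Proof.
rewrite /ordZ2; case: pselect => // h xi.
by case: ex_minnP => m _; apply.
Qed.

Lemma trunc_ordZ2 x : trunc x (ordZ2 x) = 0%N.
Proof.
rewrite /trunc big1 // => i _; case E: digit => //.
by have := ordZ2_min E; rewrite leqNgt ltn_ord.
Qed.

Lemma trunc_pow k x n :
  (k <= n)%N -> trunc (2%:R ^+ k * x) n = (2 ^ k * trunc x (n - k))%N.
Proof.
move=> kn; rewrite -natrX truncM trunc_nat modnMml.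
rewrite -(@trunc_mod x n (n - k)) ?leq_subr //.
by rewrite muln_modr -expnD subnKC.
Qed.

Lemma digit_pow k x i : digit (2%:R ^+ k * x) (k + i) = digit x i.
Proof.
have := trunc_pow x (leq_addr i.+1 k); rewrite addnS truncS.
rewrite trunc_pow ?leq_addr // -addnS !addKn truncS mulnDr => /addnI/eqP.
rewrite mulnCA -expnD eqn_pmul2r ?expn_gt0 // => /eqP.
by case: (digit _ (k + i)); case: (digit x i).
Qed.

Lemma truncDdrop x k : x = (trunc x k)%:R + 2%:R ^+ k * dropZ2 k x.
Proof.
suff h n : trunc x (k + n) =
    trunc ((trunc x k)%:R + 2%:R ^+ k * dropZ2 k x) (k + n).
  apply: trunc_inj => n.
  by rewrite -(trunc_mod x (leq_addl k n)) h trunc_mod // leq_addl.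
rewrite truncD trunc_nat modnDml trunc_pow ?leq_addr // addKn.
rewrite modn_small.
  elim: n => [|n IH]; first by rewrite addn0 trunc0 muln0 addn0.
  by rewrite addnS !truncS IH mulnDr addnA expnD mulnCA.
rewrite expnD; apply: (@leq_trans (2 ^ k * (trunc (dropZ2 k x) n).+1)%N).
  by rewrite mulnS -addSn leq_add2r trunc_lt.
by rewrite leq_mul2l trunc_lt orbT.
Qed.

Lemma ordZ2E x : x = 2%:R ^+ ordZ2 x * dropZ2 (ordZ2 x) x.
Proof. by rewrite [LHS](truncDdrop x (ordZ2 x)) trunc_ordZ2 add0r. Qed.

Lemma dropZ2_unit x : x != 0 -> dropZ2 (ordZ2 x) x \is a GRing.unit.
Proof. by move=> /digit_ordZ2; rewrite unfold_in /= /unitZ2 /= addn0. Qed.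

Lemma ordZ2_pow k x : digit x 0 -> ordZ2 (2%:R ^+ k * x) = k.
Proof.
move=> x0; set y := _ * x.
have yk : digit y k by rewrite -[k]addn0 digit_pow.
have t0 : trunc y k = 0%N by rewrite trunc_pow // subnn trunc0 muln0.
clearbody y; apply/eqP; rewrite eqn_leq ordZ2_min //= leqNgt.
apply/negP => lt; move: t0; have y0 : y != 0 by apply: contraTneq yk => ->.
rewrite /trunc (bigD1 (Ordinal lt)) //= digit_ordZ2 // mul1n.
by move/eqP; rewrite addn_eq0 expn_eq0.
Qed.

Lemma ordZ2_1 : ordZ2 1 = 0%N.
Proof. by rewrite -[1]mul1r -(expr0 2%:R) ordZ2_pow. Qed.

Lemma digitM0 x y : digit (x * y) 0 = digit x 0 && digit y 0.
Proof.
by rewrite -!(digit_odd _ 0) truncM expn1 modn2 oddb oddM.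
Qed.

Lemma ordZ2M_neq0 x y :
  x != 0 -> y != 0 -> x * y != 0 /\ ordZ2 (x * y) = (ordZ2 x + ordZ2 y)%N.
Proof.
move=> x0 y0; have e : x * y =
    2%:R ^+ (ordZ2 x + ordZ2 y) * (dropZ2 (ordZ2 x) x * dropZ2 (ordZ2 y) y).
  by rewrite exprD mulrACA -!ordZ2E.
have d : digit (dropZ2 (ordZ2 x) x * dropZ2 (ordZ2 y) y) 0.
  by rewrite digitM0; apply/andP; split; apply: dropZ2_unit.
rewrite e ordZ2_pow //; split=> //; apply/eqP => h.
have := digit_pow (ordZ2 x + ordZ2 y) (dropZ2 (ordZ2 x) x * dropZ2 (ordZ2 y) y) 0.
by rewrite h d.
Qed.

Lemma Z2_domain x y : x * y = 0 -> (x == 0) || (y == 0).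
Proof.
move=> xy0; apply/norP => -[x0 y0].
by have [] := ordZ2M_neq0 x0 y0; rewrite xy0 eqxx.
Qed.

End TwoAdicOrder.

HB.instance Definition _ := GRing.ComUnitRing_isIntegral.Build Z2 Z2_domain.

Notation Q2 := {fraction Z2}.

Section TwoAdicField.

Implicit Types (u v : Q2) (x y z : Z2) (N : int).

Definition toQ2 : {rmorphism Z2 -> Q2} := @FracField.tofrac Z2.

Definition num2 u : Z2 := (frac (repr u)).1.
Definition den2 u : Z2 := (frac (repr u)).2.

Lemma toQ2_eq0 x : (toQ2 x == 0) = (x == 0).
Proof. exact: tofrac_eq0. Qed.

Lemma toQ2_inj : injective toQ2.
Proof. by move=> x y /eqP; rewrite tofrac_eq => /eqP. Qed.

Lemma den2_neq0 u : den2 u != 0.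
Proof. exact: denom_ratioP. Qed.

Lemma num2_den2 u : u = toQ2 (num2 u) / toQ2 (den2 u).
Proof.
apply: (@mulIf _ (toQ2 (den2 u))); first by rewrite toQ2_eq0 den2_neq0.
rewrite divfK ?toQ2_eq0 ?den2_neq0 //.
rewrite /toQ2 /num2 /den2 -{1}[u]reprK; set r := repr u.
rewrite /GRing.mul /=; unlock FracField.tofrac; rewrite -FracField.pi_mul.
apply/eqmodP.
rewrite /= FracField.equivfE /FracField.mulf /= !numden_Ratio ?oner_eq0 ?mulr1 //.
  by rewrite mulrC.
all: exact: denom_ratioP.
Qed.

Definition v2 u : \bar int :=
  if u == 0 then +oo%E else ((ordZ2 (num2 u))%:Z - (ordZ2 (den2 u))%:Z)%:E.

(* The coefficient c_n of 2 ^ n in the 2-adic expansion of u: with k the      *)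
(* order of the denominator of u, 2 ^ k * u is a 2-adic integer, and c_n is   *)
(* its digit of index n + k.                                                  *)
Definition digitQ2 u (n : int) : bool :=
  let k := ordZ2 (den2 u) in
  if n + k%:Z is Posz i then digit (num2 u / dropZ2 k (den2 u)) i else false.

Definition floor2 u : rat :=
  \sum_(n \in [set n : int | n <= 0]) (digitQ2 u n)%:R * (2 : rat) ^ n.

Lemma v2_0 : v2 0 = +oo%E.
Proof. by rewrite /v2 eqxx. Qed.

Lemma v2_frac x y : x != 0 -> y != 0 ->
  v2 (toQ2 x / toQ2 y) = ((ordZ2 x)%:Z - (ordZ2 y)%:Z)%:E.
Proof.
move=> x0 y0; set u := _ / _.
have u0 : u != 0 by rewrite mulf_neq0 ?invr_eq0 ?toQ2_eq0.
have d0 := den2_neq0 u.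
have n0 : num2 u != 0.
  by apply: contraNneq u0 => n0; rewrite (num2_den2 u) n0 rmorph0 mul0r.
have e : num2 u * y = x * den2 u.
  apply: toQ2_inj; rewrite !rmorphM; apply/eqP.
  by rewrite -eqr_div ?toQ2_eq0 // -num2_den2.
rewrite /v2 (negPf u0); congr EFin.
have := congr1 ordZ2 e.
have [_ ->] := ordZ2M_neq0 n0 y0; have [_ ->] := ordZ2M_neq0 x0 d0 => h.
by apply/eqP; rewrite subr_eq addrAC eq_sym subr_eq -!PoszD h.
Qed.

Lemma v2M u v : v2 (u * v) = (v2 u + v2 v)%E.
Proof.
have [->|u0] := eqVneq u 0.
  by rewrite mul0r v2_0 /v2; case: eqP.
have [->|v0] := eqVneq v 0.
  by rewrite mulr0 v2_0 /v2; case: eqP.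
have nu0 : num2 u != 0.
  by apply: contraNneq u0 => n0; rewrite (num2_den2 u) n0 rmorph0 mul0r.
have nv0 : num2 v != 0.
  by apply: contraNneq v0 => n0; rewrite (num2_den2 v) n0 rmorph0 mul0r.
have [n0 nE] := ordZ2M_neq0 nu0 nv0.
have [d0 dE] := ordZ2M_neq0 (den2_neq0 u) (den2_neq0 v).
rewrite [u in LHS]num2_den2 [v in LHS]num2_den2 mulf_div -!rmorphM v2_frac //.
by rewrite /v2 (negPf u0) (negPf v0) nE dE !PoszD opprD addrACA.
Qed.

Lemma v2_2X k : v2 (2%:R ^+ k) = k%:Z%:E.
Proof.
have -> : 2%:R ^+ k = toQ2 (2%:R ^+ k * 1) / toQ2 1 :> Q2.
  by rewrite mulr1 rmorph1 divr1 rmorphXn rmorph_nat.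
have pk : 2%:R ^+ k * 1 != 0 :> Z2.
  by apply/eqP => h; have := digit_pow k 1 0; rewrite h.
by rewrite v2_frac ?oner_eq0 // ordZ2_pow // ordZ2_1 subr0.
Qed.

Lemma v2_Z2 x : (0 <= v2 (toQ2 x))%E.
Proof.
have [->|x0] := eqVneq x 0; first by rewrite rmorph0 v2_0.
by rewrite -[toQ2 x]divr1 -(rmorph1 toQ2) v2_frac ?oner_eq0 // ordZ2_1 subr0.
Qed.

Lemma v2_Z2P u : reflect (exists x, u = toQ2 x) (0 <= v2 u)%E.
Proof.
apply: (iffP idP) => [|[x ->]]; last exact: v2_Z2.
have [->|u0] := eqVneq u 0; first by exists 0; rewrite rmorph0.
rewrite /v2 (negPf u0) lee_fin subr_ge0 lez_nat => le.
have d0 := den2_neq0 u; have du := dropZ2_unit d0.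
exists (2%:R ^+ (ordZ2 (num2 u) - ordZ2 (den2 u)) *
  dropZ2 (ordZ2 (num2 u)) (num2 u) / dropZ2 (ordZ2 (den2 u)) (den2 u)).
apply: (@mulIf _ (toQ2 (den2 u))); first by rewrite toQ2_eq0.
rewrite {1}[u]num2_den2 divfK ?toQ2_eq0 // -rmorphM; congr (toQ2 _).
rewrite [X in _ = _ * X]ordZ2E [X in X = _]ordZ2E mulrCA.
by rewrite divrK // mulrA -exprD subnKC.
Qed.

Lemma v2D u v : (Order.min (v2 u) (v2 v) <= v2 (u + v)%R)%E.
Proof.
wlog le : u v / (v2 u <= v2 v)%E.
  by move=> h; case/orP: (le_total (v2 u) (v2 v)) => /h //; rewrite minC addrC.
rewrite (min_idPl le).
have [u0|u0] := eqVneq u 0.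
  by move: le; rewrite u0 add0r v2_0.
have [x vx] : exists x, v / u = toQ2 x.
  apply/v2_Z2P; move: le; have -> : v2 v = (v2 (v / u)%R + v2 u)%E.
    by rewrite -v2M divfK.
  have : v2 u \is a fin_num by rewrite /v2 (negPf u0).
  case: (v2 u) => // r _; case: (v2 (v / u)%R) => //= s.
  by rewrite -EFinD !lee_fin lerDr.
have -> : u + v = toQ2 (1 + x) * u.
  by rewrite rmorphD rmorph1 -vx mulrDl mul1r divfK.
by rewrite v2M leeDr // v2_Z2.
Qed.

(* The 2-adic integer 2 ^ k * u, for k the order of the denominator of u.     *)
Let scaled u : Z2 := num2 u / dropZ2 (ordZ2 (den2 u)) (den2 u).

Let scaledP u : u = toQ2 (scaled u) / 2%:R ^+ ordZ2 (den2 u).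
Proof.
have d0 := den2_neq0 u; have du := dropZ2_unit d0.
have t0 : 2%:R != 0 :> Q2.
  by apply/eqP => h; have := v2_2X 1; rewrite expr1 h v2_0.
rewrite {1}[u]num2_den2; apply/eqP; rewrite eqr_div ?toQ2_eq0 ?expf_neq0 //.
rewrite -(rmorph_nat toQ2) -rmorphXn -!rmorphM; apply/eqP; congr (toQ2 _).
by rewrite {2}[den2 u]ordZ2E mulrCA /scaled divrK // mulrC.
Qed.

(* Partial sums of the expansion, in any field where 2 is invertible.         *)
Lemma digit_sum (F : fieldType) u (j : nat) : 2%:R != 0 :> F ->
  let k := ordZ2 (den2 u) in
  \sum_(n \in [set n : int | n < j%:Z - k%:Z]) (digitQ2 u n)%:R * (2 : F) ^ n =
  (trunc (scaled u) j)%:R / 2%:R ^+ k.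
Proof.
move=> t0 k.
rewrite (@fsbigE _ _ _ _ _ [seq i%:Z - k%:Z | i <- iota 0 j]).
- rewrite big_map -[X in iota 0 X]subn0 -/(index_iota 0 j) big_mkord.
  rewrite /trunc natr_sum mulr_suml.
  apply: eq_big => [i|i _]; first by rewrite mem_set //= ltrD2r ltz_nat.
  rewrite /digitQ2 -/k subrK /= -/(scaled u).
  by rewrite natrM natrX -mulrA expfzDr // exprnN.
- by rewrite map_inj_uniq ?iota_uniq // => a b /addIr [].
- move=> n /= /mapP [i]; rewrite mem_iota => /andP[_ ij] ->.
  by rewrite ltrD2r ltz_nat.
- move=> n /= nj nin; rewrite /digitQ2 -/k.
  case E : (n + k%:Z) => [i|i]; last by rewrite mul0r.
  case/mapP: nin; exists i; last by rewrite -E addrK.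
  by rewrite mem_iota /= add0n -ltz_nat -E -ltrBrDr.
Qed.

Lemma two_neq0 : 2%:R != 0 :> Q2.
Proof. by apply/eqP => h; have := v2_2X 1; rewrite expr1 h v2_0. Qed.

Lemma v2_2Z (n : int) : v2 (2%:R ^ n) = n%:E.
Proof.
case: n => n; first exact: v2_2X.
have : v2 (2%:R ^ Negz n * 2%:R ^+ n.+1) = 0%E.
  rewrite NegzE -exprnN mulVf ?expf_neq0 ?two_neq0 //.
  exact: (v2_2X 0).
rewrite v2M v2_2X; case: v2 => //= r; rewrite -EFinD => -[/eqP].
by rewrite addr_eq0 NegzE => /eqP ->.
Qed.

(* The expansion of u converges to u.                                         *)
Lemma digitQ2P u N : (N%:E <= v2 (u -
  \sum_(n \in [set n : int | n < N]) (digitQ2 u n)%:R * (2 : Q2) ^ n)%R)%E.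
Proof.
set k := ordZ2 (den2 u); have e := scaledP u; rewrite -/k in e.
have uE : u = toQ2 (scaled u) * 2%:R ^ (- k%:Z) by rewrite -exprnN.
case E : (N + k%:Z) => [j|j].
  have -> : N = j%:Z - k%:Z by rewrite -E addrK.
  rewrite digit_sum ?two_neq0 // -/k {1}e -mulrBl exprnN.
  rewrite {1}(truncDdrop (scaled u) j) rmorphD rmorph_nat addrAC subrr.
  rewrite add0r rmorphM rmorphXn rmorph_nat !v2M v2_2X v2_2Z.
  by rewrite EFinD leeD2r // leeDl // v2_Z2.
have Nk : N < - k%:Z by rewrite -subr_lt0 opprK E.
rewrite fsbig1 ?subr0 => [|n /= nN].
  rewrite {1}uE v2M v2_2Z; apply: (@le_trans _ _ (- k%:Z)%R%:E).
    by rewrite lee_fin ltW.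
  by rewrite leeDr // v2_Z2.
rewrite /digitQ2 -/k; case E' : (n + k%:Z) => [i|i]; last by rewrite mul0r.
suff : n + k%:Z < 0 by rewrite E'.
by rewrite -ltrBrDr sub0r (lt_trans nN).
Qed.

Lemma floor2P u : exists m k : nat, [/\ floor2 u = m%:R / 2%:R ^+ k,
  0 <= floor2 u < 2%:R & (0 < v2 (u - m%:R / 2%:R ^+ k)%R)%E].
Proof.
set k := ordZ2 (den2 u).
have N1 : 1 = k.+1%:Z - k%:Z by rewrite -addn1 PoszD addrAC subrr.
have e (F : fieldType) : 2%:R != 0 :> F ->
    \sum_(n \in [set n : int | n < 1]) (digitQ2 u n)%:R * (2 : F) ^ n =
    (trunc (scaled u) k.+1)%:R / 2%:R ^+ k by move=> t0; rewrite N1 digit_sum.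
have fE : floor2 u = (trunc (scaled u) k.+1)%:R / 2%:R ^+ k.
  by rewrite -e.
exists (trunc (scaled u) k.+1), k; split; first exact: fE.
  rewrite fE divr_ge0 ?exprn_ge0 // ltr_pdivrMr ?exprn_gt0 // -exprS -natrX ltr_nat.
  exact: trunc_lt.
rewrite -e ?two_neq0 //; apply: lt_le_trans (digitQ2P u 1).
by rewrite lte_fin.
Qed.

End TwoAdicField.

Section Algorithm.

Variables (R : realType) (K : fieldExtType rat).
Variables (sigma : {rmorphism K -> R}) (sigma2 : {rmorphism K -> Q2}).

Implicit Types (alpha : K) (eps : bool) (n : nat).

Definition minimizer (f : int -> R) (i : int) := forall j, f i <= f j.

(* The smallest minimizer of f (0 if there is none).                          *)
Definition argmin (f : int -> R) : int :=
  xget 0 [set i | minimizer f i /\ forall j, minimizer f j -> i <= j].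

Lemma argminP (x c : R) (w : int) : 0 < w ->
  let f i := `|x - (w * i)%:~R - c| in
  minimizer f (argmin f) /\ forall j, minimizer f j -> argmin f <= j.
Proof.
move=> w0 f; pose g : R := w%:~R; pose y := (x - c) / g.
have g0 : 0 < g by rewrite ltr0z.
have fE i : f i = g * `|y - i%:~R|.
  rewrite -{1}(gtr0_norm g0) -normrM mulrBr /y mulrC divfK ?gt_eqF //.
  by rewrite /f intrM addrAC.
pose m := Num.floor y; have /andP[m1 m2] := floor_itv y.
rewrite -/m intrD in m1 m2.
have low i : i < m -> f m < f i.
  move=> im; rewrite !fE ltr_pM2l // ger0_norm ?subr_ge0 //.
  apply: lt_le_trans (ler_norm _); rewrite ltrD2l ltrN2 ltr_int //.
have high i : m + 1 < i -> f (m + 1) < f i.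
  move=> im; rewrite !fE ltr_pM2l // distrC ger0_norm ?subr_ge0 ?intrD 1?ltW //.
  rewrite distrC; apply: lt_le_trans (ler_norm _).
  by rewrite ltrD2r -intrD ltr_int.
have dich i : [\/ i < m, i = m, i = m + 1 | m + 1 < i].
  have [im|im|->] := ltgtP i m; [by constructor 1| |by constructor 2].
  have : m + 1 <= i by rewrite lezD1.
  by rewrite le_eqVlt => /predU1P[<-|?]; [constructor 3|constructor 4].
have best : minimizer f (if f m <= f (m + 1) then m else m + 1).
  move=> j; have [h|h] := leP (f m) (f (m + 1)); case: (dich j) => [/low|->|->|/high] //.
  - exact: ltW.
  - by move/ltW; apply: le_trans.
  - by move/ltW; apply: le_trans; apply: ltW.
  - exact: ltW.
  - exact: ltW.
have ex : exists i, minimizer f i /\ forall j, minimizer f j -> i <= j.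
  exists (if f m <= f (m + 1) then m else m + 1); split=> // j mj.
  case: (dich j) mj => [/low h|->|->|/ltW jm] mj.
  - by have := mj m; rewrite leNgt h.
  - by move: (mj (m + 1)) => ->.
  - by case: ifP => // _; rewrite lerDl.
  - by case: ifP => // _; apply: le_trans jm; rewrite lerDl.
case: ex => i; rewrite /argmin; case: xgetP => // h.
by move=> /h.
Qed.

Definition property_I alpha :=
  -1 < sigma alpha <= 1 /\ (0 < v2 (sigma2 alpha))%E.

(* eps = true stands for the exponent 1, eps = false for the exponent 0.      *)
Definition a_eps eps alpha : rat :=
  let c := floor2 (sigma2 alpha^-1) in
  let w : int := if eps then 1 else 2 in
  (w * argmin (fun i => `|sigma alpha^-1 - (w * i)%:~R - ratr c|))%:~R + c.

Definition T2 eps alpha : K := alpha^-1 - (a_eps eps alpha)%:A.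

(* With indices shifted by one: complete_quotient alpha n is alpha_(n+1).     *)
Fixpoint complete_quotient alpha n : K :=
  if n is m.+1 then T2 (odd n) (complete_quotient alpha m) else alpha.

(* a_n, for n >= 1.                                                           *)
Definition partial_quotient alpha n : rat :=
  a_eps (odd n) (complete_quotient alpha n.-1).

Definition cf_matrix (a : rat) : 'M[rat]_2 :=
  \matrix_(i, j) if i == 0 then (j == 1)%:R else if j == 0 then 1 else a.

(* For n = 0 the last column (0, 1) of the identity is (p_0, q_0).            *)
Definition convergent_matrix alpha n : 'M[rat]_2 :=
  \prod_(1 <= i < n.+1) cf_matrix (partial_quotient alpha i).

Definition cf_p alpha n : rat := convergent_matrix alpha n 0 1.
Definition cf_q alpha n : rat := convergent_matrix alpha n 1 1.

End Algorithm.

(* Main.v *)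
(* Let P_n = alpha_(1) ... alpha_(n). Then p_n - alpha q_n = +- P_(n+1), and
   |P_n| <= 2^-(n/2) in R because every second complete quotient is at most
   1/2 in absolute value. It remains to see that q_n is not small. Let alpha'
   be the conjugate of alpha. The norm of p_n - alpha q_n, that is
     N_n = P_(n+1)^2 +- P_(n+1) q_n (alpha - alpha'),
   is a nonzero rational with only powers of 2 and a bounded factor d in its
   denominator. All alpha_(n) and all q_n P_n are 2-adically integral, hence
   so is d N_n, which is therefore an integer, and |N_n| >= 1 / d in R. Since
   P_(n+1) tends to 0, eventually |q_n (alpha - alpha')| >= 1, whence
   |alpha - p_n / q_n| = |P_(n+1)| / |q_n| <= |P_(n+1)| |alpha - alpha'|. *)

Require Import Defs.
From mathcomp Require Import all_boot all_order all_algebra all_field.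
From mathcomp Require Import boolp classical_sets fsbigop.
From mathcomp Require Import reals constructive_ereal topology normedtype.
From mathcomp Require Import sequences.
From mathcomp Require Import ring lra.

Import Order.TTheory GRing.Theory Num.Theory.
Import numFieldNormedType.Exports.

Local Open Scope ring_scope.
Local Open Scope classical_set_scope.

(** * The ring Z[1/2] and its 2-adically integral elements *)

Definition dyadic (x : rat) := exists j, x * 2%:R ^+ j \is a Num.int.

Lemma dyadic_int (x : rat) : x \is a Num.int -> dyadic x.
Proof. by move=> xi; exists 0%N; rewrite expr0 mulr1. Qed.

Lemma dyadicD (x y : rat) : dyadic x -> dyadic y -> dyadic (x + y).
Proof.
move=> [j hx] [k hy]; exists (j + k)%N.
rewrite mulrDl {1}exprD mulrA addnC exprD mulrA.
by apply: rpredD; apply: rpredM => //; apply: rpredX; apply: rpred_nat.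
Qed.

Lemma dyadicM (x y : rat) : dyadic x -> dyadic y -> dyadic (x * y).
Proof.
move=> [j hx] [k hy]; exists (j + k)%N.
by rewrite exprD mulrACA; apply: rpredM.
Qed.

(** After clearing 2 ^ j, the integer [m] is 2 ^ j times a 2-adic integer, so its [j] lowest digits
    vanish and 2 ^ j divides it. *)
Lemma dyadic_integral2_int (f : {rmorphism rat -> Q2}) (x : rat) (z : Z2) :
  dyadic x -> f x = toQ2 z -> x \is a Num.int.
Proof.
move=> [j /intrP [m xm]] fx.
have zm : m%:~R = 2%:R ^+ j * z.
  apply: toQ2_inj; rewrite rmorph_int rmorphM rmorphXn rmorph_nat -fx.
  by rewrite mulrC -(rmorph_int f) -xm rmorphM rmorphXn rmorph_nat.
(* [trunc_nat] reads the digits of natural numbers only, hence the passage to the absolute value. *)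
have [w wm] : exists w : Z2, `|m|%N%:R = 2%:R ^+ j * w :> Z2.
  case: m {xm} zm => m zm; first by exists z.
  by exists (- z); rewrite mulrN -zm NegzE abszN rmorphN opprK.
have : (2 ^ j %| `|m|)%N.
  rewrite /dvdn; have /= := congr1 (fun u => trunc u j) wm.
  by rewrite trunc_nat trunc_pow // subnn Defs.trunc0 muln0 => ->.
move=> /dvdnP [k mk].
have t0 : 2%:R ^+ j != 0 :> rat by rewrite expf_neq0.
have -> : x = (Num.sg m * k%:Z)%:~R.
  apply: (mulIf t0); rewrite xm -natrX -[(_ ^ j)%:R]/((2 ^ j)%N%:Z%:~R).
  by rewrite -rmorphM -mulrA -PoszM -mk -intEsg.
exact: intr_int.
Qed.

Section Convergence.

Variables (R : realType) (K : fieldExtType rat).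
Variables (sigma : {rmorphism K -> R}) (sigma2 : {rmorphism K -> Q2}).

(** * 2-adic integrality in K *)

Lemma rmorph_in_alg (F : unitRingType) (f : {rmorphism K -> F}) (x : rat) :
  f x%:A = ratr x.
Proof. exact: (fmorph_eq_rat (f \o in_alg K)). Qed.

Lemma in_algE (x : rat) : x%:A = in_alg K x.
Proof. by []. Qed.

Definition integral2 (x : K) := exists z, sigma2 x = toQ2 z.

Lemma integral2D (x y : K) : integral2 x -> integral2 y -> integral2 (x + y).
Proof. by move=> [z hz] [w hw]; exists (z + w); rewrite !rmorphD hz hw. Qed.

Lemma integral2M (x y : K) : integral2 x -> integral2 y -> integral2 (x * y).
Proof. by move=> [z hz] [w hw]; exists (z * w); rewrite !rmorphM hz hw. Qed.

Lemma integral2N (x : K) : integral2 x -> integral2 (- x).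
Proof. by move=> [z hz]; exists (- z); rewrite !rmorphN hz. Qed.

Lemma integral2_int (m : int) : integral2 m%:~R.
Proof. by exists m%:~R; rewrite !rmorph_int. Qed.

(** * One step of the algorithm *)

(** A minimizer does at least as well as an integer nearest to (x - c) / w. *)
Lemma argmin_le (x c : R) (w : int) : 0 < w ->
  `|x - (w * argmin (fun i => `|x - (w * i)%:~R - c|))%:~R - c| <= w%:~R / 2.
Proof.
move=> w0; have [/= h _] := argminP x c w0.
have g0 : 0 < w%:~R :> R by rewrite ltr0z.
pose y := (x - c) / w%:~R.
have := floor_itv (y + 2^-1); set k := Num.floor _ => /andP[k1 k2].
apply: le_trans (h k) _.
have -> : x - (w * k)%:~R - c = w%:~R * (y - k%:~R).
  by rewrite mulrBr /y mulrCA divff ?gt_eqF // mulr1 intrM addrAC.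
rewrite normrM gtr0_norm // ler_pM2l //.
rewrite intrD in k2; rewrite ler_norml; lra.
Qed.

Lemma dyadic_a_eps (eps : bool) (x : K) : dyadic (a_eps sigma sigma2 eps x).
Proof.
rewrite /a_eps; apply: dyadicD; first by apply: dyadic_int; exact: intr_int.
have [m [k [-> _ _]]] := floor2P (sigma2 x^-1).
by exists k; rewrite divfK ?expf_neq0 // rpred_nat.
Qed.

(** Subtracting the 2-adic floor from 1 / x leaves a positive valuation, and the rest of [a_eps] is
    an integer. *)
Lemma integral2_T2 (eps : bool) (x : K) : integral2 (T2 sigma sigma2 eps x).
Proof.
rewrite /T2 /a_eps scalerDl opprD addrCA.
apply: integral2D.
  by rewrite -[X in integral2 (- X)]/(in_alg K _) rmorph_int -rmorphN; exact: integral2_int.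
have [m [k [-> _ /ltW /v2_Z2P [z zE]]]] := floor2P (sigma2 x^-1).
exists z; rewrite -zE rmorphB; congr (_ - _).
rewrite -[LHS]/((sigma2 \o in_alg K) _) fmorph_div rmorphXn !rmorph_nat //.
Qed.

Lemma norm_T2 (eps : bool) (x : K) :
  `|sigma (T2 sigma sigma2 eps x)| <= if eps then 2^-1 else 1.
Proof.
rewrite /T2 rmorphB rmorph_in_alg /a_eps rmorphD rmorph_int opprD addrA.
by case: eps; apply: le_trans (argmin_le _ _ _ _) _ => //; lra.
Qed.

Lemma T2_irrational (eps : bool) (x : K) :
  x \notin 1%VS -> T2 sigma sigma2 eps x \notin 1%VS.
Proof.
apply: contra => h; rewrite -rpredV -(subrK (a_eps sigma sigma2 eps x)%:A x^-1).
by apply: rpredD => //; rewrite rpredZ ?mem1v.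
Qed.

(** * Complete quotients and their products *)

Variable alpha : K.
Hypothesis irrational : alpha \notin 1%VS.
Hypothesis alphaI : property_I sigma sigma2 alpha.

Local Notation cq := (complete_quotient sigma sigma2 alpha).
Local Notation pq := (partial_quotient sigma sigma2 alpha).
Local Notation M := (convergent_matrix sigma sigma2 alpha).
Local Notation p := (cf_p sigma sigma2 alpha).
Local Notation q := (cf_q sigma sigma2 alpha).

Lemma integral2_cq (n : nat) : integral2 (cq n).
Proof.
case: n => [|n]; last exact: integral2_T2.
by case: alphaI => _ /ltW /v2_Z2P.
Qed.

Lemma cq_irrational (n : nat) : cq n \notin 1%VS.
Proof. by elim: n => //= n IH; exact: T2_irrational. Qed.

Lemma cq_neq0 (n : nat) : cq n != 0.
Proof. by apply: contraNneq (cq_irrational n) => ->; exact: mem0v. Qed.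

(** Property I settles index 0; the later odd indices arise from steps with [eps = true]. *)
Lemma norm_cq (n : nat) : `|sigma (cq n)| <= if odd n then 2^-1 else 1.
Proof.
case: n => [|n]; last exact: norm_T2.
by case: alphaI => /andP[h1 h2] _; rewrite ler_norml h2 ltW.
Qed.

(** This inverse-free form of [T2] shows that [pq n.+1] becomes 2-adically integral once multiplied
    by [cq n]. *)
Lemma cqS (n : nat) : cq n * cq n.+1 = 1 - (pq n.+1)%:A * cq n.
Proof. by rewrite /= /T2 mulrBr divff ?cq_neq0 // [cq n * _]mulrC. Qed.

(* The product of the first n complete quotients is, up to sign, the error
   p_(n-1) - alpha q_(n-1). *)
Definition cq_prod (n : nat) : K := \prod_(i < n) cq i.

Lemma cq_prodS (n : nat) : cq_prod n.+1 = cq_prod n * cq n.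
Proof. exact: big_ord_recr. Qed.

Lemma cq_prod_neq0 (n : nat) : cq_prod n != 0.
Proof. by apply/prodf_neq0 => i _; exact: cq_neq0. Qed.

Lemma integral2_cq_prod (n : nat) : integral2 (cq_prod n).
Proof.
elim: n => [|n IH]; first by rewrite /cq_prod big_ord0; exact: (integral2_int 1).
by rewrite cq_prodS; apply: integral2M => //; exact: integral2_cq.
Qed.

Lemma norm_cq_prod (n : nat) : `|sigma (cq_prod n)| <= 2^-1 ^+ n./2.
Proof.
(* Each pair of consecutive factors contributes 1/2; an odd length leaves one more factor, of even
   index, bounded by 1. *)
suff h k : `|sigma (cq_prod k.*2)| <= 2^-1 ^+ k.
  rewrite -{1}[n]odd_double_half; case: (odd n); last by rewrite add0n.
  rewrite cq_prodS rmorphM normrM -[leRHS]mulr1 ler_pM //.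
  by have := norm_cq n./2.*2; rewrite odd_double.
elim: k => [|k IH]; first by rewrite /cq_prod big_ord0 rmorph1 normr1.
rewrite doubleS !cq_prodS !rmorphM !normrM exprSr -mulrA ler_pM ?mulr_ge0 //.
rewrite -[leRHS]mul1r ler_pM //.
  by have := norm_cq k.*2; rewrite odd_double.
by have := norm_cq k.*2.+1; rewrite /= odd_double.
Qed.

(** * Convergents and their errors *)

Lemma convergent_matrix0 : M 0 = 1.
Proof. by rewrite /convergent_matrix big_geq. Qed.

Lemma convergent_matrixS (n : nat) (i : 'I_2) :
  M n.+1 i 0 = M n i 1 /\ M n.+1 i 1 = M n i 0 + M n i 1 * pq n.+1.
Proof.
have -> : M n.+1 = M n *m cf_matrix (pq n.+1).
  by rewrite /convergent_matrix big_nat_recr.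
rewrite !mxE !big_ord_recl !big_ord0 !mxE /= !(mulr0, mulr1, add0r, addr0).
by rewrite (_ : lift ord0 ord0 = 1); last exact: val_inj.
Qed.

Lemma dyadic_convergent_matrix (n : nat) (i j : 'I_2) : dyadic (M n i j).
Proof.
elim: n j => [|n IH] j.
  by rewrite convergent_matrix0 mxE; apply: dyadic_int; exact: rpred_nat.
have [e0 e1] := convergent_matrixS n i.
case: (unliftP 0 j) => [k ->|->]; last by rewrite e0.
rewrite (_ : lift 0 k = 1) ?e1; last by apply: val_inj; case: k => [[]].
by apply: dyadicD => //; apply: dyadicM => //; exact: dyadic_a_eps.
Qed.

(** The induction carries both columns, since a new column combines the two previous ones; [cqS]
    collapses this combination to the next product. *)
Lemma convergent_error_pair (n : nat) :
  (M n 0 0)%:A - alpha * (M n 1 0)%:A = (-1) ^+ n * cq_prod n /\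
  (M n 0 1)%:A - alpha * (M n 1 1)%:A = - (-1) ^+ n * cq_prod n.+1.
Proof.
elim: n => [|n [IH0 IH1]].
  rewrite convergent_matrix0 !mxE /= cq_prodS /cq_prod big_ord0 /=.
  by rewrite !(scale0r, scale1r, mulr0, mulr1, mul1r, subr0, sub0r, expr0, mulN1r).
have [-> ->] := convergent_matrixS n 0; have [-> ->] := convergent_matrixS n 1.
rewrite IH1 exprS mulN1r; split=> //.
have -> : forall a b c d r : rat,
    (a + b * r)%:A - alpha * (c + d * r)%:A =
    (a%:A - alpha * c%:A) + (b%:A - alpha * d%:A) * r%:A :> K.
  move=> a b c d r; rewrite !in_algE !rmorphD !rmorphM /=; ring.
rewrite IH0 IH1 !cq_prodS -!mulrA cqS; ring.
Qed.

Lemma convergent_error (n : nat) :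
  (p n)%:A - alpha * (q n)%:A = - (-1) ^+ n * cq_prod n.+1.
Proof. by case: (convergent_error_pair n). Qed.

(** The powers of 2 in the denominator of [q n] come from the partial quotients; each is absorbed by
    the matching factor of [cq_prod n], through [cqS]. *)
Lemma integral2_q_cq_prod (n : nat) : integral2 ((q n)%:A * cq_prod n).
Proof.
suff [] : integral2 ((M n 1 0)%:A * cq_prod n) /\
          integral2 ((M n 1 1)%:A * cq_prod n) by [].
elim: n => [|n [IH0 IH1]].
  rewrite convergent_matrix0 !mxE /= scale0r scale1r mul0r mul1r.
  by split; [exact: (integral2_int 0)|exact: integral2_cq_prod].
have [-> ->] := convergent_matrixS n 1; rewrite cq_prodS mulrA.
split; first by apply: integral2M => //; exact: integral2_cq.
have -> : (M n 1 0 + M n 1 1 * pq n.+1)%:A * (cq_prod n * cq n) =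
    (M n 1 0)%:A * cq_prod n * cq n +
    (M n 1 1)%:A * cq_prod n * (1 - cq n * cq n.+1).
  rewrite cqS; move: (pq n.+1) => r; rewrite !in_algE !rmorphD !rmorphM /=; ring.
apply: integral2D; apply: integral2M => //; first exact: integral2_cq.
apply: integral2D; first exact: (integral2_int 1).
by apply: integral2N; apply: integral2M; exact: integral2_cq.
Qed.

(** By dimension, K is the direct sum of the lines spanned by 1 and [alpha], so the square of
    [alpha] lies in it. *)
Lemma quadratic_equation : \dim {:K} = 2%N ->
  exists b c : rat, alpha ^+ 2 + b%:A * alpha + c%:A = 0.
Proof.
move=> dK.
have a0 : alpha != 0 by apply: contraNneq irrational => ->; exact: mem0v.
have full : (1 + <[alpha]>)%VS = {:K}%VS.
  apply/eqP; rewrite eqEdim subvf dK dimv_disjoint_sum.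
    by rewrite dimv1 dim_vline a0.
  apply/eqP; rewrite -subv0; apply/subvP => v; rewrite memv_cap memv0.
  case/andP => v1 /vlineP [k vk]; rewrite vk in v1 *.
  have [->|k0] := eqVneq k 0; first by rewrite scale0r.
  by case/negP: irrational; rewrite -[alpha](scalerK k0) rpredZ.
have : alpha ^+ 2 \in (1 + <[alpha]>)%VS by rewrite full memvf.
case/memv_addP => u /vlineP [c ->] [v /vlineP [b ->] ->].
exists (- b), (- c); rewrite !scaleNr mulNr -scalerAl mul1r.
by rewrite addrK subrr.
Qed.

(** * The norm of the error *)

Section Norm.

Variables (b c : rat).
Hypothesis alpha_root : alpha ^+ 2 + b%:A * alpha + c%:A = 0.

(* The norm from K to the rationals of x - alpha y. *)
Definition norm_form (x y : rat) : rat := x ^+ 2 + b * x * y + c * y ^+ 2.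

Lemma norm_form_factor (x y : rat) :
  (norm_form x y)%:A = (x%:A - alpha * y%:A) * (x%:A + (b%:A + alpha) * y%:A).
Proof.
rewrite /norm_form !in_algE !rmorphD !rmorphM /=.
have -> : c%:A = - (alpha ^+ 2 + b%:A * alpha).
  by apply/eqP; rewrite -addr_eq0 addrC alpha_root.
ring.
Qed.

(* alpha - alpha', for alpha' = - b - alpha the conjugate of alpha. *)
Definition disc_root : K := 2%:R * alpha + b%:A.

Lemma norm_form_convergent (n : nat) :
  (norm_form (p n) (q n))%:A = - (-1) ^+ n * cq_prod n.+1 *
    (- (-1) ^+ n * cq_prod n.+1 + disc_root * (q n)%:A).
Proof.
rewrite norm_form_factor -convergent_error /disc_root; congr (_ * _); ring.
Qed.

(** The first factor is a product of nonzero quotients. If the second vanished, [alpha] would be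
    rational, or, when [q n] is 0, the first would vanish too. *)
Lemma norm_form_convergent_neq0 (n : nat) : norm_form (p n) (q n) != 0.
Proof.
have e0 : (p n)%:A - alpha * (q n)%:A != 0.
  by rewrite convergent_error mulf_neq0 ?cq_prod_neq0 // oppr_eq0 signr_eq0.
apply/eqP => f0; have := norm_form_factor (p n) (q n).
rewrite f0 scale0r => /esym/eqP; rewrite mulf_eq0 (negPf e0) /=.
have [q0|q0] := eqVneq (q n) 0.
  by move: e0; rewrite q0 scale0r !mulr0 subr0 addr0 => /negPf ->.
rewrite addr_eq0 => /eqP h; case/negP: irrational.
have -> : alpha = - (p n / q n + b)%:A.
  rewrite !in_algE rmorphD fmorph_div /= h mulNr mulfK; first ring.
  by rewrite scaler_eq0 negb_or q0 oner_eq0.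
by rewrite rpredN rpredZ ?mem1v.
Qed.

Definition denom : int := denq b * denq c.

Lemma denom_neq0 : denom != 0.
Proof. by rewrite mulf_neq0 ?denq_neq0. Qed.

Lemma denom_b : exists m : int, denom%:~R * b = m%:~R.
Proof.
by exists (denq c * numq b); rewrite !intrM numqE; ring.
Qed.

Lemma denom_c : exists m : int, denom%:~R * c = m%:~R.
Proof. by exists (denq b * numq c); rewrite !intrM numqE; ring. Qed.

(** As a polynomial in [p n] and [q n] the number is dyadic; through its factorization it is also
    2-adically integral. *)
Lemma denom_norm_form_convergent_int (n : nat) :
  denom%:~R * norm_form (p n) (q n) \is a Num.int.
Proof.
have [mb db] := denom_b; have [mc dc] := denom_c.
have dp : dyadic (p n) by exact: dyadic_convergent_matrix.
have dq : dyadic (q n) by exact: dyadic_convergent_matrix.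
have di (m : int) : dyadic m%:~R by apply: dyadic_int; exact: intr_int.
suff [z hz] : integral2 (denom%:~R * norm_form (p n) (q n))%:A.
  apply: (@dyadic_integral2_int (sigma2 \o in_alg K) _ z) => //.
  have -> : denom%:~R * norm_form (p n) (q n) = denom%:~R * (p n * p n) +
      denom%:~R * b * (p n * q n) + denom%:~R * c * (q n * q n).
    by rewrite /norm_form; ring.
  rewrite db dc.
  by apply: dyadicD; [apply: dyadicD|]; do ?apply: dyadicM.
rewrite -[X in integral2 X]/(in_alg K _) rmorphM rmorph_int /= norm_form_convergent.
(* Splitting [cq n] off one product pairs [q n] with [cq_prod n], as [integral2_q_cq_prod]
   requires. *)
have -> : denom%:~R * (- (-1) ^+ n * cq_prod n.+1 *
      (- (-1) ^+ n * cq_prod n.+1 + disc_root * (q n)%:A)) =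
    denom%:~R * (cq_prod n.+1 * cq_prod n.+1) -
    (-1) ^+ n * cq n * ((q n)%:A * cq_prod n) * (denom%:~R * disc_root).
  have s2 : (-1) ^+ n * (-1) ^+ n = 1 :> K by rewrite -expr2 sqrr_sign.
  move: ((-1) ^+ n) (q n)%:A s2 => s Q s2.
  rewrite -[X in _ = X - _]mul1r -[X in _ = X * _ - _]s2 cq_prodS; ring.
have int2 m := integral2_int m.
apply: integral2D.
  by apply: integral2M => //; apply: integral2M; exact: integral2_cq_prod.
apply/integral2N/integral2M.
  apply: integral2M; last exact: integral2_q_cq_prod.
  apply: integral2M; last exact: integral2_cq.
  by have := int2 ((-1) ^+ n); rewrite rmorphXn rmorphN1.
rewrite /disc_root mulrDr; apply: integral2D.
  apply: integral2M => //; apply: integral2M; first exact: (int2 2).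
  exact: (integral2_cq 0).
have -> : denom%:~R * b%:A = mb%:~R :> K.
  by rewrite -!(rmorph_int (in_alg K)) -db (rmorphM (in_alg K)).
exact: int2.
Qed.

(** * Real estimates and the limit *)

(** A nonzero integer has absolute value at least 1; the triangle inequality bounds the conjugate
    factor. *)
Lemma error_lower_bound (n : nat) :
  1 <= `|denom|%:~R * (`|sigma (cq_prod n.+1)| *
    (`|sigma (cq_prod n.+1)| + `|sigma disc_root| * `|ratr (q n) : R|)).
Proof.
have nz : denom%:~R * norm_form (p n) (q n) != 0 :> rat.
  by rewrite mulf_neq0 ?intr_eq0 ?denom_neq0 ?norm_form_convergent_neq0.
have := norm_intr_ge1 (denom_norm_form_convergent_int n) nz.
rewrite -(ler_rat R) rmorph1 => /le_trans; apply.
rewrite ratr_norm rmorphM rmorph_int normrM intr_norm ler_wpM2l //.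
rewrite /= -(rmorph_in_alg _ sigma (norm_form _ _)) norm_form_convergent rmorphM normrM.
have e : `|sigma (- (-1) ^+ n * cq_prod n.+1)| = `|sigma (cq_prod n.+1)|.
  by rewrite rmorphM rmorphN rmorph_sign normrM normrN normr_sign mul1r.
rewrite e ler_wpM2l // rmorphD; apply: le_trans (ler_normD _ _) _.
by rewrite e rmorphM normrM rmorph_in_alg.
Qed.

Lemma convergent_dist (n : nat) :
  2%:R * `|denom|%:~R * `|sigma (cq_prod n.+1)| <= 1 ->
  `|sigma alpha - ratr (p n / q n)| <=
    `|sigma (cq_prod n.+1)| * `|sigma disc_root|.
Proof.
set t := `|sigma (cq_prod n.+1)|; set D : R := `|denom|%:~R => small.
set delta := `|sigma disc_root|.
have D1 : 1 <= D by rewrite ler1z -gtz0_ge1 normr_gt0 denom_neq0.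
have t0 : 0 <= t by exact: normr_ge0.
have d0 : 0 <= delta by exact: normr_ge0.
have := error_lower_bound n; rewrite -/t -/D -/delta.
set Q := `|ratr (q n) : R| => big.
have Q0 : 0 <= Q by exact: normr_ge0.
(* Otherwise, as t <= D t <= 1/2, the quantity bounded below by 1 would be at most 3/4. *)
have dQ : 1 <= delta * Q.
  rewrite leNgt; apply/negP => lt.
  have tD : t <= D * t by rewrite ler_peMl.
  have D2 : D * t <= 2^-1 by move: small; rewrite -mulrA; lra.
  have : D * t * (t + delta * Q) <= 2^-1 * (3 / 2).
    by apply: ler_pM; rewrite ?addr_ge0 ?mulr_ge0 //; lra.
  by move: big; rewrite mulrA; lra.
(* Nonvanishing of [q n] comes for free from [dQ]. *)
have q0 : ratr (q n) != 0 :> R.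
  by apply: contraTneq dQ => q0; rewrite /Q q0 normr0 mulr0 ler10.
have -> : sigma alpha - ratr (p n / q n) =
    - (ratr (p n) - sigma alpha * ratr (q n)) / ratr (q n).
  by rewrite fmorph_div /=; field.
rewrite -!(rmorph_in_alg R sigma) -rmorphM -rmorphB convergent_error.
rewrite normrM normrN rmorphM normrM rmorphN rmorph_sign normrN normr_sign mul1r.
rewrite normfV rmorph_in_alg -/t -/Q ler_pdivrMr ?normr_gt0 //.
by rewrite -mulrA ler_peMr.
Qed.

End Norm.

Lemma cvg_cq_prod : (fun n => sigma (cq_prod n.+1)) @ \oo --> (0 : R).
Proof.
apply/cvgr0Pnorm_lt => e e0.
have h : `|2^-1 : R| < 1 by rewrite ger0_norm; lra.
have /cvgr0Pnorm_lt cvg0 := @cvg_geometric R 1 _ h.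
have [N _ hN] := cvg0 e e0.
(* The exponent in [norm_cq_prod] is half the index. *)
exists N.*2 => // n /= Nn; apply: le_lt_trans (norm_cq_prod _) _.
have NN : (N <= n.+1./2)%N by rewrite geq_half_double (leq_trans Nn).
by have /= := hN _ NN; rewrite mul1r ger0_norm ?exprn_ge0 ?invr_ge0.
Qed.

End Convergence.

Theorem theorem3p13 (R : realType) (K : fieldExtType rat)
    (quadratic : \dim {:K} = 2%N)
    (sigma : {rmorphism K -> R}) (sigma2 : {rmorphism K -> Q2})
    (alpha : K) (irrational : alpha \notin 1%VS)
    (alphaI : property_I sigma sigma2 alpha) :
  (fun n : nat =>
     ratr (cf_p sigma sigma2 alpha n / cf_q sigma sigma2 alpha n) : R)
    @ \oo --> sigma alpha.
Proof.
have [b [c root]] := quadratic_equation K alpha irrational quadratic.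
have /cvgr0Pnorm_lt small := cvg_cq_prod R K sigma sigma2 alpha alphaI.
set D : R := 2%:R * `|denom b c|%:~R; set delta := `|sigma (disc_root K alpha b)|.
have D0 : 0 < D by rewrite mulr_gt0 // ltr0z normr_gt0 denom_neq0.
have d0 : 0 <= delta by exact: normr_ge0.
apply/cvgrPdist_lt => e e0.
(* Adding 1 keeps the divisor positive without a proof that [delta] is nonzero. *)
have e1 : 0 < e / (delta + 1) by rewrite divr_gt0 // ltr_wpDl.
near=> n.
have h1 : `|sigma (cq_prod R K sigma sigma2 alpha n.+1)| < D^-1.
  by near: n; apply: small; rewrite invr_gt0.
have h2 : `|sigma (cq_prod R K sigma sigma2 alpha n.+1)| < e / (delta + 1).
  by near: n; apply: small.
apply: le_lt_trans (convergent_dist R K sigma sigma2 alpha irrational alphaI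
  b c root n _) _.
  by rewrite -/D mulrC -ler_pdivlMr // mul1r ltW.
rewrite ltr_pdivlMr ?ltr_wpDl // in h2; apply: le_lt_trans h2.
by rewrite ler_wpM2l // lerDl.
Unshelve. all: by end_near.
Qed.
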